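(* Let $R$ be a commutative ring with unity, $M$ a free $R$-module of finite rank $m$, $1\le k\le m$, $\omega_1,\dots,\omega_k\in M$, and $\Omega=\omega_1\wedge\cdots\wedge\omega_k$. Let $\eta\in\Lambda^pM$, where $k\le p\le k+\operatorname{depth} I(\Omega)-2$. Then $\eta=\omega_1\wedge\cdots\wedge\omega_k\wedge\gamma$ for some $\gamma\in\Lambda^{p-k}M$ if and only if $\eta\wedge\omega_i=0$ for $i=1,\dots,k$.
   Context: $\Lambda^qM$ is the $q$th exterior power of $M$ ($\Lambda^0M=R$, $\Lambda^qM=0$ for $q<0$ or $q>m$). $I(\Omega)\subset R$ is the ideal generated by the coefficients of $\Omega$ in the basis of $\Lambda^kM$ induced by a basis of $M$ (independent of the basis). A sequence $a_1,\dots,a_q$ in $R$ is regular if $(a_1,\dots,a_q)\ne R$ and $a_i$ is a non-zero-divisor on $R/(a_1,\dots,a_{i-1})$ for all $i$. For a proper ideal $I$, $\operatorname{depth} I$ is the supremum of lengths of regular sequences contained in $I$; $\operatorname{depth} R=\infty$. $R$ is not assumed Noetherian. *)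

(* Defs.v *)
From HB Require Import structures.
From mathcomp Require Export all_boot all_order all_algebra.

Set Implicit Arguments.
Unset Strict Implicit.
Unset Printing Implicit Defensive.

Import GRing.Theory.
Local Open Scope ring_scope.

(* Ideals are Prop-valued predicates, since R is arbitrary. *)

Definition ideal_gen (R : comPzRingType) (X : R -> Prop) (a : R) : Prop :=
  exists (n : nat) (b x : 'I_n -> R),
    (forall i, X (x i)) /\ a = \sum_(i < n) b i * x i.

(* With s = [:: a_1; ...; a_q], the element a_(i+1) is s`_i and the ideal
   (a_1, ..., a_i) is generated by take i s. *)
Definition regular_seq (R : comPzRingType) (s : seq R) : Prop :=
  ~ ideal_gen (fun y => y \in s) 1 /\
  forall i, (i < size s)%N -> forall x : R,
    ideal_gen (fun y => y \in take i s) (s`_i * x) ->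
    ideal_gen (fun y => y \in take i s) x.

(* The depth of an ideal is an extended natural number, None standing for
   infinity. It is the supremum of the lengths of the regular sequences contained
   in I when I is proper, and infinity when I = R, i.e. when 1 is in I. *)
Definition is_depth (R : comPzRingType) (I : R -> Prop) (d : option nat) : Prop :=
  let regular_in s := regular_seq s /\ (forall y, y \in s -> I y) in
  match d with
  | Some n => [/\ ~ I 1,
                  exists s, regular_in s /\ size s = n
                & forall s, regular_in s -> (size s <= n)%N]
  | None => I 1 \/ forall n, exists s, regular_in s /\ (n <= size s)%N
  end.

Definition is_basis (R : comPzRingType) (M : lmodType R) (m : nat)
    (e : 'I_m -> M) : Prop :=
  forall v : M, exists! c : {ffun 'I_m -> R}, v = \sum_(i < m) c i *: e i.

(* The exterior algebra of M, by its universal property: iota : M -> E is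
   universal among the linear maps f from M to an associative unital R-algebra
   such that f v * f v = 0 for all v. The wedge product is the product of E. *)
Definition is_exterior_algebra (R : comPzRingType) (M : lmodType R)
    (E : algType R) (iota : {linear M -> E}) : Prop :=
  (forall v : M, iota v * iota v = 0) /\
  forall (B : algType R) (f : {linear M -> B}),
    (forall v : M, f v * f v = 0) ->
    exists g : {lrmorphism E -> B},
      (forall v, g (iota v) = f v) /\
      forall h : {lrmorphism E -> B}, (forall v, h (iota v) = f v) -> h =1 g.

(* The q-th exterior power, as the degree q component of the exterior algebra:
   the R-submodule spanned by the products of q vectors of M. For q = 0 the
   product is empty, which gives the multiples of 1. *)
Definition ext_power (R : comPzRingType) (M : lmodType R) (E : algType R)
    (iota : {linear M -> E}) (q : nat) (x : E) : Prop :=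
  exists (n : nat) (c : 'I_n -> R) (v : 'I_n -> 'I_q -> M),
    x = \sum_(i < n) c i *: \prod_(j < q) iota (v i j).

(* The product over i in S is taken in increasing order of i. *)
Definition ext_basis (R : comPzRingType) (M : lmodType R) (m : nat)
    (e : 'I_m -> M) (E : algType R) (iota : {linear M -> E})
    (S : {set 'I_m}) : E :=
  \prod_(i in S) iota (e i).

(* The coordinates of w in the basis of the k-th exterior power formed by the
   ext_basis e iota S with #|S| = k are unique, so the existential only names
   them. *)
Definition coef_ideal (R : comPzRingType) (M : lmodType R) (m : nat)
    (e : 'I_m -> M) (E : algType R) (iota : {linear M -> E}) (k : nat) (w : E)
    (a : R) : Prop :=
  exists c : {set 'I_m} -> R,
    w = \sum_(S : {set 'I_m} | #|S| == k) c S *: ext_basis e iota S /\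
    ideal_gen (fun y => exists2 S : {set 'I_m}, #|S| = k & y = c S) a.

(* Main.v *)
From HB Require Import structures.
Require Import Defs.
Set Implicit Arguments.
Unset Strict Implicit.
Unset Printing Implicit Defensive.
Import GRing.Theory.
Local Open Scope ring_scope.

(* Write Omega for the product of the omega_i, and let J be the ideal they
   generate. Contracting with k coordinate functions gives, for every maximal minor a
   of the omega_i, two normal ordering identities: Omega x = 0 implies a x in J, and
   omega_i eta = 0 for all i implies a eta = Omega y for some y. Both pass to all
   a in I(Omega).
   Given a regular sequence a_1, ..., a_n in I(Omega), one shows by descending
   induction on i, as in Saito's generalization of the de Rham lemma, that modulo
   (a_1, ..., a_i) an x of degree less than n - i with Omega x = 0 lies in J. To pass
   from i + 1 to i, put a = a_(i+1), so that a x lies in J; if a (x - u), with u in J,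
   is a combination of products omega_S with #|S| = l, multiplying by the
   complementary product shows that Omega kills each coefficient modulo a, so by
   induction the coefficients can be pushed into J up to multiples of a, which
   replaces l by l + 1. For l > k nothing is left, and a can be cancelled.
   Finally, for eta as in the statement, a_1 eta = Omega y, so Omega kills y modulo
   a_1, hence y = u + a_1 f with u in J and a_1 eta = a_1 Omega f.
   The exterior algebra is replaced by its faithful action on the Fock space of
   functions on subsets of the basis, where contractions are the transposes of
   multiplications by basis vectors. *)

(** * Products of anticommuting elements *)

Lemma prod_anticomm (B : pzRingType) (I : Type) (X : I -> B) (u : seq I) (x : B) :
    (forall i, X i * x = - (x * X i)) ->
  (\prod_(i <- u) X i) * x = (-1) ^+ size u * (x * \prod_(i <- u) X i).
Proof.
move=> Xx; elim: u => [|i u IHu]; first by rewrite big_nil expr0 !mul1r mulr1.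
rewrite !big_cons -mulrA IHu [LHS]mulrA (commr_sign (X i)) -mulrA.
by rewrite (mulrA (X i)) Xx exprS mulN1r !mulNr mulrN !mulrA.
Qed.

Section AnticommutingFamily.

Variables (B : pzRingType) (I : eqType) (X : I -> B).
Hypothesis sqrX : forall i, X i * X i = 0.
Hypothesis anticommX : forall i j, X i * X j = - (X j * X i).

(** The head of [u] is located in [v] and carried past the factors in front of it. The sign stays
    existential, since every use is up to sign. *)
Lemma prod_perm_sign (u v : seq I) : perm_eq u v ->
  exists b : nat, \prod_(i <- u) X i = (-1) ^+ b * \prod_(i <- v) X i.
Proof.
elim: u v => [|i u IHu] v uv.
  by exists 0%N; rewrite (size0nil (esym (perm_size uv))) !big_nil expr0 mulr1.
have iv : i \in v by rewrite -(perm_mem uv) mem_head.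
case/splitPr: iv uv => v1 v2; rewrite perm_sym perm_catC /= perm_cons perm_catC perm_sym.
case/IHu=> b ub; exists (size v1 + b)%N.
rewrite big_cons ub [LHS]mulrA (commr_sign (X i)) -mulrA !big_cat big_cons /=.
rewrite (mulrA (\prod_(j <- v1) X j)) (prod_anticomm _ (fun j => anticommX j i)).
rewrite addnC exprD -!mulrA; congr (_ * _).
by rewrite signrMK.
Qed.

(** A repeated factor can be moved next to its twin, which produces a square. *)
Lemma prod_not_uniq (u : seq I) : ~~ uniq u -> \prod_(i <- u) X i = 0.
Proof.
elim: u => //= i u IHu; rewrite negb_and negbK big_cons => /orP[iu|/IHu->].
  have [b ->] := prod_perm_sign (perm_to_rem iu).
  by rewrite big_cons [LHS]mulrA (commr_sign (X i)) -mulrA (mulrA (X i)) sqrX mul0r mulr0.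
by rewrite mulr0.
Qed.

End AnticommutingFamily.

(** * Normal ordering *)

Section Wick.

Variables (R : comPzRingType) (N : nat).
Implicit Types x : 'M[R]_N.

Lemma scale_mxAr a (A B : 'M[R]_N) : A * (a *: B) = a *: (A * B).
Proof. by rewrite -[LHS]/(A *m _) -scalemxAr. Qed.

Lemma scale_mxAl a (A B : 'M[R]_N) : (a *: A) * B = a *: (A * B).
Proof. by rewrite -[LHS]/(_ *m B) -scalemxAl. Qed.

(** The graded Leibniz rule: as [x] moves to the right, each factor passed changes the sign and
    leaves a term in which that factor is replaced by the scalar [g b]. *)
Lemma mul_prod_commutator r x (g : 'I_r -> R) (Y : 'I_r -> 'M[R]_N) :
    (forall b, x * Y b + Y b * x = (g b)%:M) ->
  x * (\prod_b Y b) = \sum_(b < r) ((-1) ^+ b * g b) *: (\prod_i Y (lift b i))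
                      + (-1) ^+ r *: ((\prod_b Y b) * x).
Proof.
elim: r g Y => [|r IHr] g Y xY.
  by rewrite !big_ord0 add0r expr0 scale1r mulr1 mul1r.
have xY0 : x * Y ord0 = (g ord0)%:M - Y ord0 * x by rewrite -xY addrK.
rewrite big_ord_recl [X in _ = X + _]big_ord_recl mulrA xY0 mulrBl.
rewrite -[_%:M * _]/(_ *m _) mul_scalar_mx.
rewrite expr0 mul1r -addrA; congr (_ + _).
rewrite -(mulrA _ x) (IHr (g \o lift ord0) (fun i => Y (lift ord0 i))) => [|b]; last exact: xY.
rewrite mulrDr opprD; congr (_ + _).
  rewrite mulr_sumr -sumrN; apply: eq_bigr => b _.
  rewrite scale_mxAr -scaleNr lift0 exprS mulN1r mulNr; congr (- (_ * _) *: _).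
  case: r b {IHr g xY xY0} Y => [[]//|r] b.
  move=> Y; rewrite [in RHS]big_ord_recl. congr (Y _ * _); first exact/val_inj.
  by apply: eq_bigr => i _; congr Y; apply/val_inj; rewrite /= /bump /= !add1n ltnS addnS.
by rewrite scale_mxAr -scaleNr exprS mulN1r mulrA.
Qed.

(** The last [X] is moved through all the [Y]. The terms that lose one [Y b] fall under the
    induction hypothesis, and their determinants form the Laplace expansion of [\det g] along its
    last row. *)
Lemma wick r (X Y : 'I_r -> 'M[R]_N) (g : 'M[R]_r) :
    (forall a b, X a * Y b + Y b * X a = (g a b)%:M) ->
  exists Z : 'I_r -> 'M[R]_N,
    (\prod_a X a) * (\prod_b Y b) =
    ((-1) ^+ 'C(r, 2) * \det g)%:M + \sum_a Z a * X a.
Proof.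
elim: r X Y g => [|r IHr] X Y g XY.
  by exists (fun=> 0); rewrite !big_ord0 mulr1 det_mx00 mulr1 addr0 expr0.
have /fin_all_exists[Z' DZ] : forall b : 'I_r.+1, exists Z : 'I_r -> 'M[R]_N,
    \prod_(i < r) X (lift ord_max i) * \prod_(i < r) Y (lift b i) =
    ((-1) ^+ 'C(r, 2) * \det (row' ord_max (col' b g)))%:M
      + \sum_a Z a * X (lift ord_max a).
  by move=> b; apply: IHr => i j; rewrite XY !mxE.
have lift_widen i : widen_ord (leqnSn r) i = lift ord_max i.
  by apply/val_inj; rewrite /= /bump leqNgt ltn_ord.
rewrite big_ord_recr /= -mulrA (@mul_prod_commutator _ _ (g ord_max)) //.
under eq_bigr do rewrite lift_widen.
rewrite mulrDr mulr_sumr scale_mxAr mulrA.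
pose c (b : 'I_r.+1) := (-1) ^+ b * g ord_max b.
(* The entry at [ord_max] is the term where the last [X] has passed every [Y]; the other entries
   collect the remainders of the induction. *)
exists (fun a => if unlift ord_max a is Some i then \sum_b c b *: Z' b i
                 else (-1) ^+ r.+1 *: ((\prod_(i < r) X (lift ord_max i)) * \prod_b Y b)).
rewrite [X in _ = _ + X]big_ord_recr /= unlift_none scale_mxAl addrA; congr (_ + _).
rewrite (eq_bigr (fun b => (c b * ((-1) ^+ 'C(r, 2) * \det (row' ord_max (col' b g))))%:M
    + \sum_a c b *: (Z' b a * X (lift ord_max a)))) => [|b _]; last first.
  by rewrite scale_mxAr DZ scalerDr scale_scalar_mx scaler_sumr.
rewrite big_split; congr (_ + _).
  rewrite (expand_det_row _ ord_max) mulr_sumr raddf_sum; apply: eq_bigr => b _.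
  congr (_%:M); rewrite /c /cofactor exprD binS bin1 exprD.
  (* ['C(r.+1, 2)] exceeds ['C(r, 2)] by [r], and the cofactor sign contributes a second
     [(-1) ^+ r], so the two cancel. *)
  rewrite -[LHS]mul1r -[X in X * _ = _](sqrr_sign _ r) expr2 /=.
  by rewrite [LHS](AC (2 * (2 * 2)) ((5 * 1) * (4 * ((2 * 3) * 6)))).
rewrite exchange_big; apply: eq_bigr => a _.
by rewrite lift_widen liftK mulr_suml; apply: eq_bigr => b _; rewrite scale_mxAl.
Qed.
End Wick.

(** * Fock space *)

Lemma mulmx_mulr (R : pzRingType) N p (A B : 'M[R]_N) (x : 'M_(N, p)) :
  (A * B) *m x = A *m (B *m x).
Proof. exact: esym (mulmxA A B x). Qed.

Section Fock.

Variables (R : comPzRingType) (m : nat).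
Local Notation N := #|{set 'I_m}|.
Implicit Types (i j : 'I_m) (l q : nat) (S T : {set 'I_m}).

Definition fock_basis T : 'cV[R]_N := delta_mx (enum_rank T) 0.

(* The sign of sorting i into T in e_i * e_T. *)
Definition jw_sign i T : R := (-1) ^+ #|[set j in T | (j < i)%N]|.

(** The matrix of left multiplication by [e_i] in the basis of sorted products [e_T]. *)
Definition creation i : 'M[R]_N := \matrix_(a, b)
  let S : {set _} := enum_val a in let T : {set _} := enum_val b in
  if (i \notin T) && (S == i |: T) then jw_sign i T else 0.

(* The projection onto the component of degree q - l, which is zero if q < l. *)
Definition degree_proj l q : 'M[R]_N :=
  diag_mx (\row_a (#|(enum_val a : {set _})| + l == q)%N%:R).

Lemma mul_fock_basis (A : 'M[R]_N) S T :
  (A *m fock_basis T) (enum_rank S) 0 = A (enum_rank S) (enum_rank T).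
Proof. by rewrite -colE mxE. Qed.

Lemma fock_basisE S T : fock_basis T (enum_rank S) 0 = (S == T)%:R.
Proof. by rewrite mxE eqxx andbT (inj_eq enum_rank_inj). Qed.

Lemma eq_on_fock_basis (A B : 'M[R]_N) :
  (forall T, A *m fock_basis T = B *m fock_basis T) -> A = B.
Proof.
move=> AB; apply/matrixP=> a b.
by rewrite -(enum_valK a) -(enum_valK b) -!mul_fock_basis AB.
Qed.

Lemma fock_sum (x : 'cV[R]_N) : x = \sum_T x (enum_rank T) 0 *: fock_basis T.
Proof.
apply/colP=> a; rewrite -(enum_valK a) summxE (bigD1 (enum_val a : {set _})) //=.
rewrite mxE fock_basisE eqxx mulr1 big1 ?addr0 // => T nTa.
by rewrite mxE fock_basisE eq_sym (negPf nTa) mulr0.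
Qed.

Lemma fock_eqP (x y : 'cV[R]_N) : (forall S, x (enum_rank S) 0 = y (enum_rank S) 0) -> x = y.
Proof. by move=> xy; apply/colP=> a; rewrite -(enum_valK a). Qed.

Lemma creation_basis i T :
  creation i *m fock_basis T = if i \in T then 0 else jw_sign i T *: fock_basis (i |: T).
Proof.
apply: fock_eqP => S; rewrite mul_fock_basis mxE !enum_rankK.
rewrite /=; case: (i \in T); rewrite mxE //= fock_basisE.
by case: eqP; rewrite ?mulr1 ?mulr0.
Qed.

Lemma annihilation_basis i T :
  (creation i)^T *m fock_basis T =
  if i \in T then jw_sign i (T :\ i) *: fock_basis (T :\ i) else 0.
Proof.
apply: fock_eqP => S; rewrite mul_fock_basis !mxE !enum_rankK /=.
case: (boolP (i \in T)) => iT; last first.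
  by rewrite mxE; case: andP => // -[_ /eqP TS]; rewrite TS setU11 in iT.
rewrite mxE fock_basisE.
case: (S =P T :\ i) => [->|neqS].
  by rewrite !inE eqxx /= setD1K // eqxx mulr1.
by rewrite mulr0; case: andP => // -[iS /eqP TS]; case: neqS; rewrite TS setU1K.
Qed.

Lemma degree_projE l q (x : 'cV[R]_N) T :
  (degree_proj l q *m x) (enum_rank T) 0 = (#|T| + l == q)%N%:R * x (enum_rank T) 0.
Proof. by rewrite mul_diag_mx !mxE enum_rankK. Qed.

Lemma degree_proj_basis l q T :
  degree_proj l q *m fock_basis T = (#|T| + l == q)%N%:R *: fock_basis T.
Proof.
apply: fock_eqP => S; rewrite degree_projE [RHS]mxE !fock_basisE.
by case: (S =P T) => [->|_] //; rewrite !mulr0.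
Qed.

Lemma degree_proj_idem l q : degree_proj l q * degree_proj l q = degree_proj l q.
Proof.
apply: eq_on_fock_basis => T; rewrite mulmx_mulr degree_proj_basis -scalemxAr degree_proj_basis.
by rewrite scalerA; case: eqP; rewrite /= ?mulr1 ?mulr0.
Qed.

Lemma jw_signU1 i j T : i \notin T -> jw_sign j (i |: T) = (-1) ^+ (i < j)%N * jw_sign j T.
Proof.
move=> iT; rewrite /jw_sign -exprD; congr (_ ^+ _).
have -> : [set l in i |: T | (l < j)%N] = if (i < j)%N then i |: [set l in T | (l < j)%N]
   else [set l in T | (l < j)%N].
  case: ifP => ij; apply/setP => l; rewrite !inE.
    by case: (l =P i) => [->|]; rewrite ?ij.
  by case: (l =P i) => [->|]; rewrite ?ij ?andbF.
by case: ifP => ij //=; rewrite cardsU1 !inE (negPf iT).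
Qed.

Lemma degree_proj_creation l q i : degree_proj l q * creation i = creation i * degree_proj l.+1 q.
Proof.
apply: eq_on_fock_basis => T; rewrite !mulmx_mulr degree_proj_basis -scalemxAr !creation_basis.
case: ifP => [_|/negbT iT]; first by rewrite mulmx0 scaler0.
by rewrite -scalemxAr degree_proj_basis !scalerA mulrC cardsU1 iT add1n addSnnS.
Qed.

Lemma creation_sqr i : creation i * creation i = 0.
Proof.
apply: eq_on_fock_basis => T; rewrite mulmx_mulr mul0mx creation_basis.
by case: ifP; rewrite ?mulmx0 // -scalemxAr creation_basis setU11 scaler0.
Qed.

Lemma sign_ltn_anti i j : i != j -> (-1) ^+ (i < j)%N + (-1) ^+ (j < i)%N = 0 :> R.
Proof.
by rewrite -val_eqE /= neq_ltn; case: ltngtP => //= _ _; rewrite expr0 expr1 (subrr, addNr).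
Qed.

Lemma sign_ltn_mul i j : i != j -> (-1) ^+ (i < j)%N * (-1) ^+ (j < i)%N = - 1 :> R.
Proof.
by rewrite -val_eqE /= neq_ltn; case: ltngtP => //= _ _; rewrite expr0 expr1 (mulr1, mul1r).
Qed.

(** If [T] contains neither index, the two orders of insertion differ only in whether the index
    inserted first is counted by the sign of the other, and exactly one of [i < j] and [j < i]
    holds. *)
Lemma creation_anticomm i j : creation i * creation j = - (creation j * creation i).
Proof.
have [->|neq_ij] := eqVneq i j; first by rewrite creation_sqr oppr0.
apply/eqP; rewrite -addr_eq0; apply/eqP.
apply: eq_on_fock_basis => T; rewrite mulmxDl !mulmx_mulr mul0mx !creation_basis.
case: (boolP (i \in T)) => iT; case: (boolP (j \in T)) => jT; rewrite ?mulmx0 ?addr0 ?add0r //.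
- by rewrite -scalemxAr creation_basis !inE iT orbT scaler0.
- by rewrite -scalemxAr creation_basis !inE jT orbT scaler0.
rewrite -!scalemxAr !creation_basis !inE (negPf iT) (negPf jT) ?(eq_sym j i) !(negPf neq_ij) /=.
rewrite !scalerA setUCA -scalerDl !jw_signU1 //.
rewrite mulrCA [X in _ + X]mulrCA (mulrC (jw_sign i T)) -mulrDl.
by rewrite addrC sign_ltn_anti // mul0r scale0r.
Qed.

(** The canonical anticommutation relations. For [i = j] exactly one summand survives on each basis
    vector; for [i != j] both survive when [i] is in [T] and [j] is not, with opposite signs. *)
Lemma annihilation_creation i j :
  (creation i)^T * creation j + creation j * (creation i)^T = (i == j)%:R%:M.
Proof.
apply: eq_on_fock_basis => T.
rewrite mulmxDl !mulmx_mulr mul_scalar_mx creation_basis annihilation_basis.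
have [<-|neq_ij] := eqVneq i j.
  case: ifP => [|/negbT] iT.
    rewrite mulmx0 add0r -scalemxAr creation_basis !inE eqxx /= scalerA setD1K //.
    by rewrite /jw_sign -expr2 sqrr_sign.
  rewrite mulmx0 addr0 -scalemxAr annihilation_basis setU11 scalerA setU1K //.
  by rewrite /jw_sign -expr2 sqrr_sign.
rewrite scale0r; case: (boolP (j \in T)) => jT; case: (boolP (i \in T)) => iT;
  rewrite ?mulmx0 ?addr0 ?add0r //.
- by rewrite -scalemxAr creation_basis !inE jT eq_sym neq_ij scaler0.
- rewrite -!scalemxAr creation_basis annihilation_basis !inE iT (negPf jT) orbT andbF.
  (* Both orders end at [j |: T'], so the signs are compared over the common part [T']. *)
  set T' := T :\ i.
  have iT' : i \notin T' by rewrite !inE eqxx.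
  have jT' : j \notin T' by rewrite !inE negb_and jT orbT.
  have -> : (j |: T) :\ i = j |: T'.
    by apply/setP => l; rewrite !inE; case: eqP => [->|] //=; rewrite (negPf neq_ij).
  rewrite -[T](setD1K iT) -/T' !jw_signU1 // !scalerA -scalerDl.
  by rewrite mulrACA sign_ltn_mul // mulN1r mulrC addNr scale0r.
- by rewrite -scalemxAr annihilation_basis !inE (negPf iT) (negPf neq_ij) scaler0.
Qed.

End Fock.

(** * Division modulo a regular sequence *)

Section IdealGen.

Variables (R : comPzRingType).
Implicit Types (X Y : R -> Prop) (a b c : R).

Lemma mem_ideal_gen X a : X a -> ideal_gen X a.
Proof. by move=> Xa; exists 1%N, (fun=> 1), (fun=> a); rewrite big_ord1 mul1r. Qed.

Lemma ideal_gen0 X : ideal_gen X 0.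
Proof. by exists 0%N, (fun=> 0), (fun=> 0); split=> [[]//|]; rewrite big_ord0. Qed.

Lemma ideal_genM X c a : ideal_gen X a -> ideal_gen X (c * a).
Proof.
move=> [n [b [x [Xx ->]]]]; exists n, (fun i => c * b i), x; split=> //.
by rewrite mulr_sumr; apply: eq_bigr => i _; rewrite mulrA.
Qed.

Lemma ideal_genD X a b : ideal_gen X a -> ideal_gen X b -> ideal_gen X (a + b).
Proof.
move=> [n1 [b1 [x1 [X1 ->]]]] [n2 [b2 [x2 [X2 ->]]]].
exists (n1 + n2)%N, (fun i => match split i with inl j => b1 j | inr j => b2 j end),
  (fun i => match split i with inl j => x1 j | inr j => x2 j end).
split=> [i|]; first by case: (split i).
rewrite big_split_ord; congr (_ + _); apply: eq_bigr => i _.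
  by rewrite -[lshift n2 i]/(unsplit (inl i)) unsplitK.
by rewrite -[rshift n1 i]/(unsplit (inr i)) unsplitK.
Qed.

Lemma ideal_gen_sum X (I : finType) (P : pred I) (F : I -> R) :
  (forall i, P i -> ideal_gen X (F i)) -> ideal_gen X (\sum_(i | P i) F i).
Proof. by move=> XF; elim/big_ind: _ => //; [exact: ideal_gen0|exact: ideal_genD]. Qed.

Lemma ideal_gen_trans X Y a :
  (forall b, X b -> ideal_gen Y b) -> ideal_gen X a -> ideal_gen Y a.
Proof. by move=> XY [n [b [x [Xx ->]]]]; apply: ideal_gen_sum => i _; apply/ideal_genM/XY. Qed.

Lemma ideal_gen_take (s : seq R) i a : (i < size s)%N ->
  ideal_gen (fun y : R => y \in take i.+1 s) a ->
  exists r, ideal_gen (fun y : R => y \in take i s) (a - s`_i * r).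
Proof.
move=> i_s [n [b [x [sx ->]]]].
have /fin_all_exists[r rP] : forall j, exists r,
    ideal_gen (fun y : R => y \in take i s) (b j * x j - s`_i * r).
  move=> j; have := sx j; rewrite (take_nth 0) // mem_rcons inE => /orP[/eqP->|xs].
    by exists (b j); rewrite mulrC subrr; apply: ideal_gen0.
  by exists 0; rewrite mulr0 subr0; apply/ideal_genM/mem_ideal_gen.
by exists (\sum_j r j); rewrite mulr_sumr -sumrB; apply: ideal_gen_sum => j _.
Qed.

Lemma ideal_gen_False a : ideal_gen (fun y => y \in [::]) a -> a = 0.
Proof. by case=> [[|n]] [b [x [sx ->]]]; [rewrite big_ord0|have := sx ord0]. Qed.

End IdealGen.

Section IdealColumns.

Variables (R : comPzRingType) (n : nat).
Implicit Types (X Y : R -> Prop) (x y : 'cV[R]_n).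

(** Congruence to zero modulo the ideal generated by [X], used in place of a quotient ring. *)
Definition col_in_ideal X x := forall a, ideal_gen X (x a 0).

Lemma col_in_ideal0 X : col_in_ideal X 0.
Proof. by move=> a; rewrite mxE; apply: ideal_gen0. Qed.

Lemma col_in_idealD X x y : col_in_ideal X x -> col_in_ideal X y -> col_in_ideal X (x + y).
Proof. by move=> Xx Xy a; rewrite mxE; apply: ideal_genD. Qed.

Lemma col_in_ideal_sum X (I : finType) (Q : pred I) (F : I -> 'cV[R]_n) :
  (forall i, Q i -> col_in_ideal X (F i)) -> col_in_ideal X (\sum_(i | Q i) F i).
Proof. by move=> XF; elim/big_ind: _ => //; [exact: col_in_ideal0|exact: col_in_idealD]. Qed.

Lemma col_in_ideal_mul X (A : 'M[R]_n) x : col_in_ideal X x -> col_in_ideal X (A *m x).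
Proof. by move=> Xx a; rewrite mxE; apply: ideal_gen_sum => b _; apply: ideal_genM. Qed.

Lemma col_in_idealN X x : col_in_ideal X x -> col_in_ideal X (- x).
Proof. by move=> Xx a; rewrite mxE -mulN1r; apply: ideal_genM. Qed.

Lemma col_in_idealZ X c x : X c -> col_in_ideal X (c *: x).
Proof. by move=> Xc a; rewrite mxE mulrC; apply/ideal_genM/mem_ideal_gen. Qed.

Lemma col_in_ideal_trans X Y x :
  (forall b, X b -> Y b) -> col_in_ideal X x -> col_in_ideal Y x.
Proof. by move=> XY Xx a; apply: ideal_gen_trans (Xx a) => b /XY; apply: mem_ideal_gen. Qed.

Lemma col_in_ideal_take (s : seq R) i x : (i < size s)%N ->
  col_in_ideal (fun y : R => y \in take i.+1 s) x ->
  exists f, col_in_ideal (fun y : R => y \in take i s) (x - s`_i *: f).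
Proof.
move=> i_s sx; have /fin_all_exists[f fP] a := ideal_gen_take i_s (sx a).
by exists (\col_a f a) => a; rewrite !mxE.
Qed.

End IdealColumns.

(** * Saito's division argument for anticommuting operators *)

Section Division.

Variables (R : comPzRingType) (m k : nat).
Local Notation N := #|{set 'I_m}|.
Local Notation V := 'cV[R]_N.
Local Notation P := (@degree_proj R m).
Variable W : 'I_k -> 'M[R]_N.
Hypothesis sqrW : forall b, W b * W b = 0.
Hypothesis anticommW : forall b c, W b * W c = - (W c * W b).
Hypothesis degW : forall l q b, P l q * W b = W b * P l.+1 q.

Let Omega := \prod_(b < k) W b.
Let WS (S : {set 'I_k}) := \prod_(b <- enum S) W b.

(** The ideal J and, in [powW], its [l]-th power, in the Fock model. By anticommutation, products
    over subsets suffice for the power. *)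
Definition linW (x : V) := exists eps : 'I_k -> V, x = \sum_b W b *m eps b.
Definition powW l (x : V) :=
  exists delta : {set 'I_k} -> V, x = \sum_(S : {set 'I_k} | #|S| == l) WS S *m delta S.

Lemma signM_mulmx n (A : 'M[R]_N) (x : V) : ((-1) ^+ n * A) *m x = A *m ((-1) ^+ n *: x).
Proof.
elim: n => [|n IHn]; first by rewrite !expr0 mul1r scale1r.
by rewrite !exprS !mulN1r mulNr mulNmx IHn scaleNr mulmxN.
Qed.

Lemma deg_prodW l q (u : seq 'I_k) :
  P l q * \prod_(b <- u) W b = (\prod_(b <- u) W b) * P (l + size u) q.
Proof.
elim: u l => [|b u IHu] l; first by rewrite big_nil mulr1 mul1r addn0.
by rewrite big_cons mulrA degW -(mulrA (W b)) IHu mulrA addSnnS.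
Qed.

Lemma WS_W b (S : {set 'I_k}) :
  exists n, W b * WS S = if b \in S then 0 else (-1) ^+ n * WS (b |: S).
Proof.
have -> : W b * WS S = \prod_(c <- b :: enum S) W c by rewrite big_cons.
case: (boolP (b \in S)) => bS.
  by exists 0%N; apply: (prod_not_uniq sqrW anticommW); rewrite /= mem_enum bS.
apply: (prod_perm_sign anticommW); apply: uniq_perm => [||c].
- by rewrite /= mem_enum bS enum_uniq.
- exact: enum_uniq.
- by rewrite inE !mem_enum !inE.
Qed.

(** Such a [T] is not contained in [S], so it meets the complement and a factor repeats. Together
    with [WS_complK], multiplication by [WS (~: S)] isolates the [S] term of a combination of
    products of equal length. *)
Lemma WS_compl (S T : {set 'I_k}) : #|S| = #|T| -> S != T -> WS (~: S) * WS T = 0.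
Proof.
move=> cST neqST; rewrite -big_cat; apply: (prod_not_uniq sqrW anticommW).
rewrite cat_uniq !enum_uniq andbT /= negbK.
have /subsetPn[b bT bS] : ~~ (T \subset S).
  by apply: contra neqST => TS; rewrite eq_sym eqEcard TS cST /=.
by apply/hasP; exists b; rewrite mem_enum // inE.
Qed.

Lemma WS_complK (S : {set 'I_k}) : exists n, WS (~: S) * WS S = (-1) ^+ n * Omega.
Proof.
rewrite -big_cat /Omega; apply: (prod_perm_sign anticommW); apply: uniq_perm.
- rewrite cat_uniq !enum_uniq andbT /=; apply/hasPn => b.
  by rewrite !mem_enum inE negbK.
- exact: index_enum_uniq.
by move=> b; rewrite mem_cat !mem_enum inE mem_index_enum orNb.
Qed.

Lemma OmegaW b : Omega * W b = 0.
Proof.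
have -> : W b = \prod_(c <- [:: b]) W c by rewrite big_seq1.
rewrite /Omega -big_cat; apply: (prod_not_uniq sqrW anticommW).
by rewrite cat_uniq /= mem_index_enum /= andbF.
Qed.

Lemma linW0 : linW 0.
Proof. by exists (fun=> 0); rewrite big1 // => b _; rewrite mulmx0. Qed.

Lemma linWD x y : linW x -> linW y -> linW (x + y).
Proof.
move=> [e ->] [f ->]; exists (fun b => e b + f b); rewrite -big_split.
by apply: eq_bigr => b _; rewrite mulmxDr.
Qed.

Lemma linW_mem b x : linW (W b *m x).
Proof.
exists (fun c => if c == b then x else 0); rewrite (bigD1 b) //= eqxx.
by rewrite big1 ?addr0 // => c /negPf->; rewrite mulmx0.
Qed.

Lemma linW_sum (I : finType) (Q : pred I) (F : I -> V) :
  (forall i, Q i -> linW (F i)) -> linW (\sum_(i | Q i) F i).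
Proof. by move=> WF; elim/big_ind: _ => //; [exact: linW0|exact: linWD]. Qed.

Lemma linW_proj l q x : linW x -> linW (P l q *m x).
Proof.
move=> [e ->]; rewrite mulmx_sumr; apply: linW_sum => b _.
by rewrite -mulmx_mulr degW mulmx_mulr; apply: linW_mem.
Qed.

Lemma powW_mem (S : {set 'I_k}) x : powW #|S| (WS S *m x).
Proof.
exists (fun T => if T == S then x else 0); rewrite (bigD1 S) //= eqxx.
by rewrite big1 ?addr0 // => T /andP[_ /negPf->]; rewrite mulmx0.
Qed.

Lemma powW0 l : powW l 0.
Proof. by exists (fun=> 0); rewrite big1 // => b _; rewrite mulmx0. Qed.

Lemma powWD l x y : powW l x -> powW l y -> powW l (x + y).
Proof.
move=> [e ->] [f ->]; exists (fun b => e b + f b); rewrite -big_split.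
by apply: eq_bigr => b _; rewrite mulmxDr.
Qed.

Lemma powW_sum l (I : finType) (Q : pred I) (F : I -> V) :
  (forall i, Q i -> powW l (F i)) -> powW l (\sum_(i | Q i) F i).
Proof. by move=> WF; elim/big_ind: _ => //; [exact: powW0|exact: powWD]. Qed.

Lemma powW_W l b x : powW l x -> powW l.+1 (W b *m x).
Proof.
move=> [e ->]; rewrite mulmx_sumr; apply: powW_sum => S /eqP Sl.
rewrite -mulmx_mulr; have [n ->] := WS_W b S; case: ifP => [|/negbT bS].
  by rewrite mul0mx => _; apply: powW0.
have <- : #|b |: S| = l.+1 by rewrite cardsU1 bS Sl.
by rewrite signM_mulmx; apply: powW_mem.
Qed.

Lemma powW_WS_W (S : {set 'I_k}) b x : powW #|S|.+1 (WS S *m (W b *m x)).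
Proof.
rewrite -mulmx_mulr prod_anticomm // signM_mulmx mulmx_mulr.
exact/powW_W/powW_mem.
Qed.

Lemma powW1_linW x : linW x -> powW 1 x.
Proof.
move=> [e ->]; apply: powW_sum => b _; apply: powW_W.
have -> : e b = WS set0 *m e b by rewrite /WS enum_set0 big_nil mul1mx.
by have := powW_mem set0 (e b); rewrite cards0.
Qed.

Lemma linW_powW l x : (0 < l)%N -> powW l x -> linW x.
Proof.
move=> l_gt0 [e ->]; apply: linW_sum => S /eqP Sl.
have /card_gt0P[b bS] : (0 < #|S|)%N by rewrite Sl.
rewrite -(setD1K bS); have [n] := WS_W b (S :\ b); rewrite setD11 => WE.
rewrite -[WS _](signrMK n) -WE signM_mulmx mulmx_mulr; exact: linW_mem.
Qed.

Lemma powW_gt l x : (k < l)%N -> powW l x -> x = 0.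
Proof.
move=> kl [e ->]; rewrite big_pred0 // => S; apply: contraTF kl => /eqP <-.
by rewrite -leqNgt -[k in (_ <= k)%N]card_ord max_card.
Qed.

Variable s : seq R.
Hypothesis regs : forall i, (i < size s)%N -> forall x : R,
  ideal_gen (fun y : R => y \in take i s) (s`_i * x) -> ideal_gen (fun y : R => y \in take i s) x.
Hypothesis homotopy_l : forall a, a \in s -> exists D (Z : 'I_k -> 'M[R]_N),
  D * Omega = a%:M + \sum_b W b * Z b.

Local Notation modA i := (@col_in_ideal R N (fun y : R => y \in take i s)).

Lemma deg_WS l q (S : {set 'I_k}) : P l q * WS S = WS S * P (l + #|S|) q.
Proof. by rewrite deg_prodW -cardE. Qed.

Lemma deg_Omega l q : P l q * Omega = Omega * P (l + k) q.
Proof.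
rewrite deg_prodW; suff -> : size (index_enum 'I_k) = k by [].
by rewrite [index_enum _]unlock -enumT size_enum_ord.
Qed.

Lemma mem_take_nth i : (i < size s)%N -> s`_i \in take i.+1 s.
Proof. by move=> i_s; rewrite (take_nth 0) // mem_rcons mem_head. Qed.

Lemma modA_S i (x : V) : modA i x -> modA i.+1 x.
Proof.
apply: col_in_ideal_trans => b; case: (ltnP i (size s)) => i_s.
  by rewrite (take_nth 0 i_s) mem_rcons inE orbC => ->.
by rewrite !take_oversize // ltnW.
Qed.

(** The inner induction, on [t], within the descending one on [i]: each round corrects [u] so that
    [a *: (x - u)] falls into the next power of J modulo the first [i] terms of [s]. *)
Lemma saito_step i n l q x a : (i < size s)%N -> a = s`_i ->
    (forall l x, (q < l + n)%N -> P l q *m x = x -> modA i.+1 (Omega *m x) ->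
      exists2 u, linW u & modA i.+1 (x - u)) ->
    (q < l + n.+1)%N -> P l q *m x = x -> modA i (Omega *m x) ->
  forall t, exists u x1, [/\ linW u, powW t.+1 x1 & modA i (a *: (x - u) - x1)].
Proof.
move=> i_s def_a IHn ql Px Ox; elim=> [|t [u [x1 [Wu Wx1 u_x1]]]].
  have [D [Z DO]] := homotopy_l (mem_nth 0 i_s).
  exists 0, (- (\sum_b W b *m (Z b *m x))); split; first exact: linW0.
    rewrite -sumrN; apply/powW1_linW/linW_sum => b _.
    by rewrite -mulmxN; apply: linW_mem.
  rewrite subr0 opprK def_a -mul_scalar_mx.
  under eq_bigr do rewrite -mulmx_mulr.
  by rewrite -mulmx_suml -mulmxDl -DO mulmx_mulr; apply: col_in_ideal_mul.
(* Projecting to degree [q - l] makes the coefficients [d S] homogeneous of degree [q - (l + t.+1)],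
   as [IHn] requires. *)
case: Wx1 u_x1 => delta -> /(col_in_ideal_mul (P l q)).
rewrite mulmxBr -scalemxAr mulmxBr Px mulmx_sumr.
set u' := P l q *m u; have Wu' : linW u' by apply: linW_proj.
pose d S := P (l + t.+1) q *m delta S.
rewrite (eq_bigr (fun S => WS S *m d S)) => [|S /eqP St]; last first.
  by rewrite -mulmx_mulr deg_WS mulmx_mulr St.
set x2 := \sum_(S | _) _ => u_x2.
have Ax2 : modA i.+1 x2.
  have -> : x2 = a *: (x - u') - (a *: (x - u') - x2) by rewrite opprB addrC subrK.
  apply: col_in_idealD; last exact/col_in_idealN/modA_S.
  by rewrite def_a; apply/col_in_idealZ/mem_take_nth.
(* The claim ranges over all [S] so that [fin_all_exists] applies; sets of another size get a dummy
   pair. *)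
have /fin_all_exists[ef efP] (S : {set 'I_k}) : exists ef : V * V, #|S| == t.+1 ->
    linW ef.1 /\ modA i (d S - ef.1 - a *: ef.2).
  case: (boolP (#|S| == t.+1)) => [/eqP St|_]; last by exists 0.
  have [|||e We Ae] := IHn (l + t.+1)%N (d S).
  - by rewrite addnS addSnnS (leq_trans ql) // leq_add2r leq_addr.
  - by rewrite /d -mulmx_mulr degree_proj_idem.
  (* The complementary product turns [x2] into [Omega *m d S] up to sign, and [x2] already vanishes
     modulo the first [i.+1] terms. *)
  - have [c WSS] := WS_complK S.
    have -> : Omega = (-1) ^+ c * (WS (~: S) * WS S) by rewrite WSS signrMK.
    rewrite signM_mulmx -scalemxAr -mul_scalar_mx mulmx_mulr; apply: col_in_ideal_mul.
    suff -> : WS (~: S) *m (WS S *m d S) = WS (~: S) *m x2 by apply: col_in_ideal_mul.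
    rewrite mulmx_sumr (bigD1 S) ?St //= big1 ?addr0 // => T /andP[/eqP Tt neqTS].
    by rewrite -mulmx_mulr WS_compl ?mul0mx ?St ?Tt // eq_sym.
  have [f Af] := col_in_ideal_take i_s Ae.
  by exists (e, f) => _; rewrite def_a.
(* The multiples of [a] in the coefficients are absorbed into [u], while the parts in J raise the
   power by one. *)
pose u2 := \sum_(S : {set 'I_k} | #|S| == t.+1) WS S *m (ef S).2.
exists (u' + u2), (\sum_(S : {set 'I_k} | #|S| == t.+1) WS S *m (ef S).1); split.
- apply: linWD => //; apply: (@linW_powW t.+1) => //.
  by exists (fun S => (ef S).2).
- apply: powW_sum => S St; have [[e ->] _] := efP S St.
  rewrite mulmx_sumr; apply: powW_sum => b _.
  by have := powW_WS_W S b (e b); rewrite (eqP St).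
have -> : a *: (x - (u' + u2)) - \sum_(S : {set 'I_k} | #|S| == t.+1) WS S *m (ef S).1
   = (a *: (x - u') - x2) + \sum_(S : {set 'I_k} | #|S| == t.+1)
       WS S *m (d S - (ef S).1 - a *: (ef S).2).
  under [in RHS]eq_bigr do rewrite !mulmxBr -scalemxAr.
  rewrite !sumrB -scaler_sumr -/x2 -/u2 opprD addrA [in LHS]scalerBr.
  by rewrite !addrA subrK addrAC.
apply: col_in_idealD => //; apply: col_in_ideal_sum => S St.
by apply: col_in_ideal_mul; have [] := efP S St.
Qed.

(** The induction runs on [n], the number of terms of [s] not yet used as moduli. *)
Lemma saito_division n i l q x : (i + n)%N = size s -> (q < l + n)%N ->
    P l q *m x = x -> modA i (Omega *m x) ->
  exists2 u, linW u & modA i (x - u).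
Proof.
elim: n i l x => [|n IHn] i l x ins ql Px Ox.
  (* With no term left, [q < l], so the component of degree [q - l] is zero. *)
  exists 0; first exact: linW0.
  suff -> : x = 0 by rewrite subr0; apply: col_in_ideal0.
  rewrite -Px; apply: fock_eqP => S; rewrite degree_projE mxE.
  case: eqP => [Sq|_]; last by rewrite mul0r.
  by move: ql; rewrite addn0 -Sq ltnNge leq_addl.
have i_s : (i < size s)%N by rewrite -ins addnS ltnS leq_addr.
have IH l' x' := IHn i.+1 l' x' (etrans (addSnnS i n) ins).
(* At [t = k] the remainder lies in the power [k.+1] of J, which is zero. *)
have [u [x1 [Wu Wx1]]] := saito_step i_s erefl IH ql Px Ox k.
rewrite (powW_gt _ Wx1) // subr0 => Au; exists u => // a.
by apply: regs => //; have := Au a; rewrite mxE.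
Qed.

Hypothesis homotopy_r : forall a, a \in s -> exists D (Z : 'I_k -> 'M[R]_N),
  Omega * D = a%:M + \sum_b Z b * W b.

Lemma division_by_Omega p (x : V) : (0 < size s)%N -> (p + 2 <= k + size s)%N ->
    P 0 p *m x = x -> (forall b, W b *m x = 0) ->
  exists2 y, P k p *m y = y & x = Omega *m y.
Proof.
move=> s_gt0 ps Px Wx.
have PO y : Omega *m (P k p *m y) = P 0 p *m (Omega *m y).
  by rewrite -!mulmx_mulr deg_Omega add0n.
suff [y xy] : exists y, x = Omega *m y.
  exists (P k p *m y); first by rewrite -mulmx_mulr degree_proj_idem.
  by rewrite PO -xy Px.
have [D [Z DZ]] := homotopy_r (mem_nth 0 s_gt0).
have ODx : Omega *m (D *m x) = s`_0 *: x.
  rewrite -mulmx_mulr DZ mulmxDl mul_scalar_mx mulmx_suml big1 ?addr0 // => b _.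
  by rewrite mulmx_mulr Wx mulmx0.
(* Since [x] has degree [p], the identity for [D *m x] survives restriction to its component of
   degree [p - k]. *)
pose y0 := P k p *m (D *m x).
have Oy0 : Omega *m y0 = s`_0 *: x by rewrite PO ODx -scalemxAr Px.
(* The first term of [s] already serves as modulus. This leaves [(size s).-1] terms, and the bound
   of [saito_division] becomes [p + 2 <= k + size s]. *)
have [||||u Wu /(col_in_ideal_take s_gt0)[f]] := @saito_division (size s).-1 1 k p y0.
- by rewrite add1n prednK.
- by rewrite -ltnS -addnS prednK // -addn2.
- by rewrite -mulmx_mulr degree_proj_idem.
- by rewrite Oy0; apply: col_in_idealZ; apply: mem_take_nth s_gt0.
rewrite take0 => Ay0; exists f.
have y0E : y0 = u + s`_0 *: f.
  apply/eqP; rewrite -subr_eq0 opprD addrA; apply/eqP/colP => a.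
  by rewrite [RHS]mxE; apply: ideal_gen_False (Ay0 a).
(* The first term of [s] is cancelled as a non-zero-divisor; the part [u] in J disappears because
   [Omega] kills it. *)
apply/eqP; rewrite -subr_eq0; apply/eqP/colP => a; rewrite [RHS]mxE.
apply: ideal_gen_False; have := @regs 0 s_gt0 ((x - Omega *m f) a 0); rewrite take0; apply.
have -> : s`_0 * (x - Omega *m f) a 0 = (s`_0 *: (x - Omega *m f)) a 0 by rewrite [RHS]mxE.
rewrite scalerBr -Oy0 y0E mulmxDr -scalemxAr addrK.
case: Wu => e ->; rewrite mulmx_sumr summxE; apply: ideal_gen_sum => b _.
by rewrite -mulmx_mulr OmegaW mul0mx mxE; apply: ideal_gen0.
Qed.

End Division.

(** * Contraction homotopies *)

Section SumAnticomm.

Variables (B : pzRingType) (I : Type) (X : I -> B).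
Hypothesis sqrX : forall i, X i * X i = 0.
Hypothesis anticommX : forall i j, X i * X j = - (X j * X i).

Lemma sum_sqr0 (u : seq I) : (\sum_(i <- u) X i) * (\sum_(i <- u) X i) = 0.
Proof.
elim: u => [|i u IHu]; first by rewrite big_nil mul0r.
rewrite big_cons mulrDl !mulrDr sqrX IHu add0r addr0 mulr_sumr mulr_suml -big_split.
by rewrite big1 // => j _; rewrite /= anticommX addNr.
Qed.

End SumAnticomm.

Lemma trmx_prod (R : comPzRingType) N (I : Type) (u : seq I) (X : I -> 'M[R]_N) :
  (\prod_(i <- u) X i)^T = \prod_(i <- rev u) (X i)^T.
Proof.
elim: u => [|i u IHu]; first by rewrite !big_nil trmx1.
by rewrite rev_cons -cats1 big_cons big_cat big_seq1 trmx_mul IHu.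
Qed.

Section Homotopy.

Variables (R : comPzRingType) (m : nat).
Local Notation N := #|{set 'I_m}|.
Local Notation vac := (@fock_basis R m set0).

Definition vec_op (v : 'I_m -> R) : 'M[R]_N := \sum_i v i *: creation R i.

Lemma vec_op_sqr v : vec_op v * vec_op v = 0.
Proof.
apply: sum_sqr0 => [i|i j]; rewrite !scale_mxAl !scale_mxAr.
  by rewrite creation_sqr !scaler0.
by rewrite creation_anticomm !scalerN !scalerA mulrC.
Qed.

Lemma vec_op_anticomm u v : vec_op u * vec_op v = - (vec_op v * vec_op u).
Proof.
rewrite /vec_op mulr_suml mulr_sumr -sumrN; apply: eq_bigr => i _.
rewrite mulr_suml mulr_sumr -sumrN; apply: eq_bigr => j _.
by rewrite !scale_mxAl !scale_mxAr creation_anticomm !scalerN !scalerA mulrC.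
Qed.

Lemma vec_op_degree v l q : degree_proj R m l q * vec_op v = vec_op v * degree_proj R m l.+1 q.
Proof.
rewrite /vec_op mulr_suml mulr_sumr; apply: eq_bigr => i _.
by rewrite scale_mxAl scale_mxAr degree_proj_creation.
Qed.

Lemma annihilation_vec_op i v :
  (creation R i)^T * vec_op v + vec_op v * (creation R i)^T = (v i)%:M.
Proof.
rewrite /vec_op mulr_suml mulr_sumr -big_split (bigD1 i) //= big1 ?addr0 => [|j ji].
  rewrite scale_mxAl scale_mxAr -scalerDr annihilation_creation eqxx.
  by rewrite scale_scalar_mx mulr1.
rewrite scale_mxAl scale_mxAr -scalerDr annihilation_creation eq_sym (negPf ji).
by rewrite scale_scalar_mx mulr0 raddf0.
Qed.

Lemma creation_vac (u : seq 'I_m) : uniq u -> exists n,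
  (\prod_(i <- u) creation R i) *m vac = (-1) ^+ n *: fock_basis R [set i in u].
Proof.
elim: u => [_|i u IHu /= /andP[iu /IHu[n un]]].
  by exists 0%N; rewrite big_nil mul1mx scale1r; congr fock_basis; apply/setP => i; rewrite !inE.
rewrite big_cons mulmx_mulr un -scalemxAr creation_basis inE (negPf iu) scalerA /jw_sign -exprD.
by eexists; congr (_ *: fock_basis _ _); apply/setP => j; rewrite !inE.
Qed.

Variables (k : nat) (w : 'I_k -> 'I_m -> R).
Let W b := vec_op (w b).
Let Omega := \prod_(b < k) W b.

(** Applied to a vector [x], [homotopic_l c] puts [c *: x] in J when [Omega *m x = 0], and
    [homotopic_r c] gives [c *: x = Omega *m (D *m x)] when every [W b] kills [x]. *)
Definition homotopic_l c := exists D (Z : 'I_k -> 'M[R]_N),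
  D * Omega = c%:M + \sum_b W b * Z b.
Definition homotopic_r c := exists D (Z : 'I_k -> 'M[R]_N),
  Omega * D = c%:M + \sum_b Z b * W b.

(** Scalars with such an identity form an ideal, which leads from the minors to all of I(Omega). *)
Lemma homotopic_l_ideal (X : R -> Prop) c :
  (forall a, X a -> homotopic_l a) -> ideal_gen X c -> homotopic_l c.
Proof.
move=> XH [n [b [x [Xx ->]]]].
elim/big_ind: _ => [|c1 c2 [D1 [Z1 DZ1]] [D2 [Z2 DZ2]]|i _].
- exists 0, (fun=> 0); rewrite mul0r raddf0 big1 ?addr0 // => i _; exact: mulr0.
- exists (D1 + D2), (fun b => Z1 b + Z2 b).
  rewrite mulrDl DZ1 DZ2 raddfD addrACA -big_split; congr (_ + _).
  by apply: eq_bigr => a _; rewrite mulrDr.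
have [D [Z DZ]] := XH _ (Xx i); exists (b i *: D), (fun a => b i *: Z a).
rewrite scale_mxAl DZ scalerDr scale_scalar_mx scaler_sumr; congr (_ + _).
by apply: eq_bigr => a _; rewrite scale_mxAr.
Qed.

Lemma homotopic_r_ideal (X : R -> Prop) c :
  (forall a, X a -> homotopic_r a) -> ideal_gen X c -> homotopic_r c.
Proof.
move=> XH [n [b [x [Xx ->]]]].
elim/big_ind: _ => [|c1 c2 [D1 [Z1 DZ1]] [D2 [Z2 DZ2]]|i _].
- exists 0, (fun=> 0); rewrite mulr0 raddf0 big1 ?addr0 // => i _; exact: mul0r.
- exists (D1 + D2), (fun b => Z1 b + Z2 b).
  rewrite mulrDr DZ1 DZ2 raddfD addrACA -big_split; congr (_ + _).
  by apply: eq_bigr => a _; rewrite mulrDl.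
have [D [Z DZ]] := XH _ (Xx i); exists (b i *: D), (fun a => b i *: Z a).
rewrite scale_mxAr DZ scalerDr scale_scalar_mx scaler_sumr; congr (_ + _).
by apply: eq_bigr => a _; rewrite scale_mxAl.
Qed.

Lemma homotopic_lZ a c : homotopic_l c -> homotopic_l (a * c).
Proof.
move=> Hc; apply: (@homotopic_l_ideal (fun y => y = c)) => [_ ->//|].
by apply/ideal_genM/mem_ideal_gen.
Qed.

Lemma homotopic_rZ a c : homotopic_r c -> homotopic_r (a * c).
Proof.
move=> Hc; apply: (@homotopic_r_ideal (fun y => y = c)) => [_ ->//|].
by apply/ideal_genM/mem_ideal_gen.
Qed.

Section Minor.

Variable t : k.-tuple 'I_m.
Hypothesis Ut : uniq t.
Let A a := (creation R (tnth t a))^T.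
Let g : 'M[R]_k := \matrix_(a, b) w b (tnth t a).

Lemma minor_commutator a b : A a * W b + W b * A a = (g a b)%:M.
Proof. by rewrite mxE annihilation_vec_op. Qed.

(** [wick] leaves the uncontracted factors on the right, whereas here the [W b] must stand on the
    left. It is therefore applied to transposes and transposed back, which reverses the product of
    the [W b] and costs a sign. *)
Lemma homotopic_l_minor : homotopic_l (\det g).
Proof.
have [|Z WA] := @wick R N k (fun b => (W b)^T) (fun a => (A a)^T) g^T.
  move=> b a; apply: trmx_inj; rewrite mxE tr_scalar_mx -minor_commutator.
  by rewrite raddfD /= -!mulmxE !trmx_mul !trmxK.
have [n rW] : exists n, \prod_(b <- rev (index_enum 'I_k)) W b = (-1) ^+ n * Omega.
  apply: prod_perm_sign; first by move=> b c; apply: vec_op_anticomm.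
  by rewrite perm_rev.
have OmT : (\prod_b (W b)^T)^T = (-1) ^+ n * Omega.
  by rewrite trmx_prod -rW; apply: eq_bigr => b _; rewrite trmxK.
move/(congr1 trmx): WA; rewrite -mulmxE trmx_mul OmT mulmxE det_tr raddfD /= tr_scalar_mx => WA.
rewrite -[\det g](signrMK 'C(k, 2)); apply: homotopic_lZ.
exists ((\prod_a (A a)^T)^T * (-1) ^+ n), (fun b => (Z b)^T).
rewrite -mulrA WA raddf_sum; congr (_ + _); apply: eq_bigr => b _.
by rewrite /= -mulmxE trmx_mul trmxK.
Qed.

Lemma homotopic_r_minor : homotopic_r (\det g).
Proof.
have [|Z WA] := @wick R N k W A g^T.
  by move=> b a; rewrite mxE -minor_commutator addrC.
rewrite -[\det g](signrMK 'C(k, 2)); apply: homotopic_rZ.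
by exists (\prod_a A a), Z; rewrite WA det_tr.
Qed.

(* The vacuum expectation of both sides of wick: annihilators kill the vacuum. *)
Lemma minor_coordinate : exists n,
  (Omega *m vac) (enum_rank [set i in t]) 0 = (-1) ^+ n * \det g.
Proof.
have [Z AW] := @wick R N k A W g minor_commutator.
have [n vn] : exists n, (\prod_(i <- rev t) creation R i) *m vac
    = (-1) ^+ n *: fock_basis R [set i in rev t].
  by apply: creation_vac; rewrite rev_uniq.
exists (n + 'C(k, 2))%N.
have /(congr1 (fun x : 'cV_N => x (enum_rank set0) 0)) := congr1 (mulmx^~ vac) AW.
have Avac : (\sum_a Z a * A a) *m vac = 0.
  rewrite mulmx_suml big1 // => a _.
  by rewrite mulmx_mulr annihilation_basis inE mulmx0.
rewrite mulmxDl Avac addr0 mul_scalar_mx [in RHS]mxE fock_basisE eqxx mulr1 exprD -mulrA => <-.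
have -> : \prod_a A a = (\prod_(i <- rev t) creation R i)^T.
  by rewrite trmx_prod revK big_tuple; apply: eq_bigr.
(* A vacuum coordinate of [B^T *m x] is the scalar product of [B *m vac] with [x]. For [B] the
   product of creations along [rev t], this reads off the coordinate of [x] at the set of [t], up to
   sign. *)
have trE (B : 'M[R]_N) (x : 'cV_N) :
    (B^T *m x) (enum_rank set0) 0 = ((B *m vac)^T *m x) 0 0.
  by rewrite trmx_mul -mulmxA trmx_delta -rowE [RHS]mxE.
rewrite mulmx_mulr trE vn linearZ /= -scalemxAl [in RHS]mxE mulrA -expr2 sqrr_sign mul1r.
have -> : [set i in rev t] = [set i in t] by apply/setP => i; rewrite !inE mem_rev.
by rewrite trmx_delta -rowE [RHS]mxE.
Qed.

End Minor.

Lemma homotopic_coordinate (S : {set 'I_m}) : #|S| = k ->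
  homotopic_l ((Omega *m vac) (enum_rank S) 0) /\
  homotopic_r ((Omega *m vac) (enum_rank S) 0).
Proof.
move=> Sk; have tP : size (enum S) == k by rewrite -cardE Sk.
have [|n] := @minor_coordinate (Tuple tP); first exact: enum_uniq.
have -> : [set i in Tuple tP] = S by apply/setP => i; rewrite inE mem_enum.
move=> ->; split; first exact/homotopic_lZ/homotopic_l_minor.
exact/homotopic_rZ/homotopic_r_minor.
Qed.

End Homotopy.

(** * The exterior algebra acting on Fock space *)

(* An algType is a nontrivial ring, which 'M[R]_n is not in general. *)
Definition opmx (R : comPzRingType) n (nz : 1 != 0 :> 'M[R]_n) := 'M[R]_n.

Section OpmxAlgebra.

Variables (R : comPzRingType) (n : nat) (nz : 1 != 0 :> 'M[R]_n).

HB.instance Definition _ := GRing.PzRing.on (opmx nz).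
HB.instance Definition _ := GRing.Lmodule.on (opmx nz).
HB.instance Definition _ := GRing.PzSemiRing_isNonZero.Build (opmx nz) nz.
HB.instance Definition _ :=
  GRing.LSemiModule_isLSemiAlgebra.Build R (opmx nz) (@scalemxAl R n n n).
HB.instance Definition _ :=
  GRing.LSemiAlgebra_isSemiAlgebra.Build R (opmx nz) (@scalemxAr R n n n).

End OpmxAlgebra.

Section Transfer.

Variables (R : comPzRingType) (M : lmodType R) (m : nat) (e : 'I_m -> M).
Hypothesis he : is_basis e.

(** Boolean equality makes the coordinates available to [xchoose]. *)
Lemma coord_exists (v : M) : exists c : {ffun 'I_m -> R}, v == \sum_(i < m) c i *: e i.
Proof. by have [c [/eqP vc _]] := he v; exists c. Qed.

Definition basis_coord v := xchoose (coord_exists v).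

Lemma basis_coordP v : v = \sum_(i < m) basis_coord v i *: e i.
Proof. exact/eqP/(xchooseP (coord_exists v)). Qed.

Lemma basis_coord_unique v (c : 'I_m -> R) : v = \sum_(i < m) c i *: e i -> basis_coord v =1 c.
Proof.
have [c0 [_ c0P]] := he v => vc i.
rewrite -(c0P _ (basis_coordP v)) (c0P [ffun i => c i]) ?ffunE //.
by rewrite {1}vc; apply: eq_bigr => j _; rewrite ffunE.
Qed.

Variables (E : algType R) (iota : {linear M -> E}).
Hypothesis hE : is_exterior_algebra iota.

Lemma iota_sqr v : iota v * iota v = 0.
Proof. by have [] := hE. Qed.

Lemma iota_anticomm u v : iota u * iota v = - (iota v * iota u).
Proof.
have := iota_sqr (u + v); rewrite raddfD /= mulrDl !mulrDr !iota_sqr add0r addr0.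
by move/eqP; rewrite addr_eq0 => /eqP.
Qed.

Local Notation N := #|{set 'I_m}|.

(** Otherwise the diagonal entry at the empty set gives 1 = 0 in [R], hence in [E], which is a
    nontrivial ring. *)
Lemma id_opmx_neq0 : 1 != 0 :> 'M[R]_N.
Proof.
apply/eqP => /matrixP/(_ (enum_rank set0) (enum_rank set0)).
rewrite !mxE eqxx mulr1n => R10; have /eqP[] := oner_neq0 E.
by rewrite -[1]scale1r R10 scale0r.
Qed.

Definition vec_opmx v : opmx id_opmx_neq0 := vec_op (basis_coord v).

Lemma vec_opmx_is_linear : linear vec_opmx.
Proof.
move=> a u v; rewrite /vec_opmx /vec_op.
rewrite (eq_bigr (fun i => a *: (basis_coord u i *: creation R i) +
                           basis_coord v i *: creation R i)).
  by rewrite big_split -scaler_sumr.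
move=> i _; rewrite scalerA -scalerDl; congr (_ *: _).
apply: (@basis_coord_unique _ (fun i => a * basis_coord u i + basis_coord v i)).
rewrite {1}(basis_coordP u) {1}(basis_coordP v) scaler_sumr -big_split.
by apply: eq_bigr => j _; rewrite scalerA scalerDl.
Qed.

HB.instance Definition _ := GRing.isLinear.Build R M (opmx id_opmx_neq0) *:%R
  vec_opmx vec_opmx_is_linear.

Lemma fock_representation :
  exists rho : {lrmorphism E -> opmx id_opmx_neq0}, forall v, rho (iota v) = vec_op (basis_coord v).
Proof.
have [rho [rhoE _]] := proj2 hE _ vec_opmx (fun v => vec_op_sqr _).
by exists rho.
Qed.

Lemma vec_op_basis i : vec_op (basis_coord (e i)) = creation R i.
Proof.
have cE : basis_coord (e i) =1 fun j => (j == i)%:R.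
  apply: basis_coord_unique; rewrite (bigD1 i) //= eqxx scale1r big1 ?addr0 // => j /negPf->.
  exact: scale0r.
rewrite /vec_op (bigD1 i) //= big1 ?addr0 => [|j /negPf ji]; rewrite cE ?eqxx ?scale1r //.
by rewrite ji scale0r.
Qed.

Local Notation eS := (ext_basis e iota).

Lemma ext_basis_enum S : eS S = \prod_(i <- enum S) iota (e i).
Proof. by rewrite /ext_basis -big_filter [index_enum _]unlock. Qed.

(** Only products of basis vectors occur here, while [ext_power] admits products of arbitrary
    vectors; [ext_power_span] and [ext_span_power] identify the two. *)
Definition ext_span (q : nat) (x : E) := exists c : {set 'I_m} -> R,
  x = \sum_(S : {set 'I_m} | #|S| == q) c S *: eS S.

Lemma ext_span0 q : ext_span q 0.
Proof. by exists (fun=> 0); rewrite big1 // => S _; rewrite scale0r. Qed.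

Lemma ext_spanD q x y : ext_span q x -> ext_span q y -> ext_span q (x + y).
Proof.
move=> [c ->] [d ->]; exists (fun S => c S + d S); rewrite -big_split.
by apply: eq_bigr => S _; rewrite scalerDl.
Qed.

Lemma ext_spanZ q a x : ext_span q x -> ext_span q (a *: x).
Proof.
move=> [c ->]; exists (fun S => a * c S); rewrite scaler_sumr.
by apply: eq_bigr => S _; rewrite scalerA.
Qed.

Lemma ext_span_sum q (I : finType) (P : pred I) (F : I -> E) :
  (forall i, P i -> ext_span q (F i)) -> ext_span q (\sum_(i | P i) F i).
Proof. by move=> XF; elim/big_ind: _ => //; [exact: ext_span0|exact: ext_spanD]. Qed.

Lemma ext_span_basis (S : {set 'I_m}) : ext_span #|S| (eS S).
Proof.
exists (fun T => (T == S)%:R); rewrite (bigD1 S) //= eqxx scale1r.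
rewrite big1 ?addr0 // => T /andP[_ /negPf->].
exact: scale0r.
Qed.

Lemma ext_span_mul q v x : ext_span q x -> ext_span q.+1 (iota v * x).
Proof.
move=> [c ->]; rewrite (basis_coordP v) linear_sum mulr_suml; apply: ext_span_sum => i _.
rewrite linearZ /= -scalerAl mulr_sumr; apply/ext_spanZ/ext_span_sum => S /eqP <-.
rewrite -scalerAr; apply: ext_spanZ.
have anti j l := iota_anticomm (e j) (e l).
rewrite ext_basis_enum; have -> : iota (e i) * \prod_(j <- enum S) iota (e j) =
  \prod_(j <- i :: enum S) iota (e j) by rewrite big_cons.
case: (boolP (i \in S)) => iS.
  rewrite (prod_not_uniq (fun j => iota_sqr (e j)) anti); first exact: ext_span0.
  by rewrite /= mem_enum iS.
have [|n ->] := @prod_perm_sign _ _ _ anti (i :: enum S) (enum (i |: S)).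
  apply: uniq_perm => [||j]; rewrite /= ?mem_enum ?iS ?enum_uniq //.
  by rewrite inE !mem_enum !inE.
have -> : #|S|.+1 = #|i |: S| by rewrite cardsU1 iS.
rewrite -ext_basis_enum -signr_odd; case: odd; rewrite ?expr0 ?expr1 ?mulN1r ?mul1r -?scaleN1r.
  exact/ext_spanZ/ext_span_basis.
exact: ext_span_basis.
Qed.

Lemma ext_power_span q x : ext_power iota q x -> ext_span q x.
Proof.
move=> [n [c [v ->]]]; apply: ext_span_sum => i _; apply: ext_spanZ.
move: (v i) => {v} u; elim: q u => [|q IHq] u.
  have := ext_span_basis set0; rewrite cards0 /ext_basis big_set0.
  by rewrite big_ord0.
by rewrite big_ord_recl; apply: ext_span_mul.
Qed.

Lemma ext_span_power q x : ext_span q x -> ext_power iota q x.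
Proof.
(* The family runs over all subsets; those of the wrong size get coefficient 0, so the default of
   [nth] is harmless. *)
move=> [c ->]; exists N, (fun i => if #|(enum_val i : {set _})| == q then c (enum_val i) else 0).
exists (fun i j => nth 0 [seq e l | l <- enum (enum_val i : {set _})] j).
rewrite -(big_enum_val (fun S : {set 'I_m} => (if #|S| == q then c S else 0) *:
  \prod_(j < q) iota (nth 0 [seq e l | l <- enum S] j))) big_mkcond /=; apply: eq_bigr => S _.
case: (#|S| =P q) => [Sq|_]; last by rewrite scale0r.
congr (_ *: _); rewrite ext_basis_enum -(big_map e predT iota) (big_nth 0).
by rewrite size_map -cardE Sq big_mkord.
Qed.

Lemma ext_power_anticomm q x v : ext_power iota q x -> x * iota v = (-1) ^+ q * (iota v * x).
Proof.
move=> [n [c [u ->]]]; rewrite mulr_suml !mulr_sumr; apply: eq_bigr => i _.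
rewrite -scalerAl -!scalerAr; congr (_ *: _).
rewrite prod_anticomm => [|j]; last exact: iota_anticomm.
by rewrite [index_enum _]unlock -enumT size_enum_ord.
Qed.

(** * Comparison of the exterior powers with Fock space *)

Section FockImage.

Variable rho : {lrmorphism E -> opmx id_opmx_neq0}.
Hypothesis rhoE : forall v, rho (iota v) = vec_op (basis_coord v).

Definition fock_image (x : E) : 'cV[R]_N := (rho x : 'M[R]_N) *m fock_basis R set0.

Lemma fock_imageM x y : fock_image (x * y) = (rho x : 'M[R]_N) *m fock_image y.
Proof. by rewrite /fock_image rmorphM /= mulmxA. Qed.

Lemma fock_imageB x y : fock_image (x - y) = fock_image x - fock_image y.
Proof. by rewrite /fock_image raddfB /= mulmxBl. Qed.

Lemma fock_image_sum (I : finType) (P : pred I) (F : I -> E) :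
  fock_image (\sum_(i | P i) F i) = \sum_(i | P i) fock_image (F i).
Proof. by rewrite /fock_image raddf_sum /= mulmx_suml. Qed.

Lemma fock_imageZ a x : fock_image (a *: x) = a *: fock_image x.
Proof. by rewrite /fock_image linearZ /= -scalemxAl. Qed.

Lemma fock_image_basis (S : {set 'I_m}) : exists n, fock_image (eS S) = (-1) ^+ n *: fock_basis R S.
Proof.
have [n nP] := creation_vac R (enum_uniq S); exists n.
have -> : fock_basis R S = fock_basis R [set i in enum S].
  by congr fock_basis; apply/setP => i; rewrite inE mem_enum.
rewrite -nP /fock_image ext_basis_enum rmorph_prod /=; congr (_ *m _).
by apply: eq_bigr => i _; rewrite rhoE vec_op_basis.
Qed.

Lemma fock_image_coord q (c : {set 'I_m} -> R) (S : {set 'I_m}) : #|S| = q -> exists n,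
  fock_image (\sum_(T : {set 'I_m} | #|T| == q) c T *: eS T) (enum_rank S) 0 = (-1) ^+ n * c S.
Proof.
move=> Sq; have [n nP] := fock_image_basis S; exists n.
rewrite fock_image_sum summxE (bigD1 S) /= ?Sq // fock_imageZ nP.
rewrite mxE [X in _ * X]mxE fock_basisE eqxx mulr1 mulrC big1 ?addr0 // => T /andP[_ TS].
have [n' nT] := fock_image_basis T.
by rewrite fock_imageZ nT mxE [X in _ * X]mxE fock_basisE eq_sym (negPf TS) !mulr0.
Qed.

(** The Fock coordinates recover the coefficients up to sign, so the independence of the basis
    products of [E] comes from the representation. *)
Lemma fock_image_inj q x : ext_span q x -> fock_image x = 0 -> x = 0.
Proof.
move=> [c ->] x0; apply: big1 => S /eqP Sq.
have [n] := fock_image_coord c Sq; rewrite x0 mxE => /esym cS.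
by rewrite -[c S](signrMK n) cS mulr0 scale0r.
Qed.

Lemma fock_image_degree q x : ext_span q x -> degree_proj R m 0 q *m fock_image x = fock_image x.
Proof.
move=> [c ->]; rewrite fock_image_sum mulmx_sumr; apply: eq_bigr => S /eqP Sq.
have [n nP] := fock_image_basis S.
by rewrite fock_imageZ nP -!scalemxAr degree_proj_basis addn0 Sq eqxx scale1r.
Qed.

Lemma fock_image_surj k p (y : 'cV[R]_N) : (k <= p)%N -> degree_proj R m k p *m y = y ->
  exists2 x, ext_span (p - k) x & fock_image x = y.
Proof.
move=> kp Py; have /fin_all_exists[n nP] := fock_image_basis.
exists (\sum_(S : {set 'I_m} | #|S| == (p - k)%N) ((-1) ^+ n S * y (enum_rank S) 0) *: eS S).
  by eexists.
rewrite fock_image_sum [RHS]fock_sum [RHS](bigID (fun S : {set 'I_m} => #|S| == (p - k)%N)) /=.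
rewrite [X in _ = _ + X]big1 ?addr0 => [|S nS]; last first.
  rewrite -Py degree_projE (_ : _ == p = false) ?mul0r ?scale0r //.
  by apply: contraNF nS => /eqP <-; rewrite addnK eqxx.
by apply: eq_bigr => S _; rewrite fock_imageZ nP scalerA mulrAC -expr2 sqrr_sign mul1r.
Qed.

End FockImage.

End Transfer.

Theorem corollary2p5 (R : comPzRingType) (M : lmodType R)
    (m : nat) (e : 'I_m -> M) (he : is_basis e)
    (E : algType R) (iota : {linear M -> E}) (hE : is_exterior_algebra iota)
    (k : nat) (hk1 : (1 <= k)%N) (hkm : (k <= m)%N) (omega : 'I_k -> M)
    (d : option nat)
    (hd : is_depth (coef_ideal e iota k (\prod_(i < k) iota (omega i))) d)
    (p : nat) (eta : E) (heta : ext_power iota p eta)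
    (hkp : (k <= p)%N)
    (* p <= k + d - 2, without truncated subtraction *)
    (hpd : if d is Some n then (p + 2 <= k + n)%N else true) :
  (exists gamma : E, ext_power iota (p - k) gamma /\
     eta = (\prod_(i < k) iota (omega i)) * gamma)
  <-> (forall i : 'I_k, eta * iota (omega i) = 0).
Proof.
split=> [[gamma [pgamma ->]] i|eta_omega].
  (* The factor [omega i] is carried left past [gamma], where it repeats a factor of the product. *)
  rewrite -mulrA (ext_power_anticomm hE _ pgamma) mulrA commr_sign -!mulrA.
  rewrite (mulrA _ (iota (omega i))).
  have -> : iota (omega i) = \prod_(j <- [:: i]) iota (omega j) by rewrite big_seq1.
  rewrite -big_cat (prod_not_uniq (fun j => iota_sqr hE (omega j))) ?mul0r ?mulr0 //.
    by move=> j l; apply: iota_anticomm.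
  by rewrite cat_uniq /= mem_index_enum /= andbF.
have [rho rhoE] := fock_representation he hE.
set OmE := \prod_(i < k) iota (omega i) in hd *.
pose w i := basis_coord he (omega i); pose W i := vec_op (w i).
have rhoOm : rho OmE = \prod_(i < k) W i.
  by rewrite rmorph_prod; apply: eq_bigr => i _ /=; rewrite rhoE.
(* Since [eta] is homogeneous, left and right multiplication by [omega i] agree on it up to sign. *)
have Wphi i : W i *m fock_image rho eta = 0.
  rewrite /W /w -rhoE -fock_imageM.
  rewrite -[iota _ * _](signrMK p) -(ext_power_anticomm hE _ heta) eta_omega mulr0.
  by rewrite /fock_image raddf0 mul0mx.
(* A coefficient of [OmE] is, up to sign, a coordinate of its action on the vacuum, for which
   [homotopic_coordinate] gives both identities. *)
have coefH a : coef_ideal e iota k OmE a -> homotopic_l w a /\ homotopic_r w a.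
  case=> c [Omc ac].
  have cH b : (exists2 S : {set 'I_m}, #|S| = k & b = c S) -> homotopic_l w b /\ homotopic_r w b.
    case=> S Sk ->; have [n] := fock_image_coord rhoE c Sk.
    rewrite -Omc /fock_image rhoOm => cS; rewrite -[c S](signrMK n) -cS.
    have [Hl Hr] := homotopic_coordinate w Sk.
    by split; [apply: homotopic_lZ|apply: homotopic_rZ].
  split; first by apply: homotopic_l_ideal ac => b /cH[].
  by apply: homotopic_r_ideal ac => b /cH[].
have [s [regs sI s_gt0 ps]] : exists s : seq R, [/\
    forall i, (i < size s)%N -> forall x : R, ideal_gen (fun y => y \in take i s) (s`_i * x) ->
      ideal_gen (fun y => y \in take i s) x,
    forall a, a \in s -> coef_ideal e iota k OmE a, (0 < size s)%N & (p + 2 <= k + size s)%N].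
  (* For finite depth, [k <= p] and the bound on [p] force the sequence to be nonempty; for infinite
     depth, any length from [p + 2] on will do. *)
  case: d hd hpd => [n [_ [s [[[_ regs] sI] <-]] _] ps|[I1|Iinf] _].
  - exists s; split=> //; rewrite -(ltn_add2l k) addn0; apply: leq_trans ps.
    by rewrite addn2 ltnS leqW.
  (* Regularity is only used without properness, and 1, ..., 1 satisfies it. *)
  - exists (nseq (p + 2) 1); rewrite size_nseq addn2 leq_addl; split=> //.
      by move=> i ip x; rewrite nth_nseq ip mul1r.
    by move=> a; rewrite mem_nseq => /andP[_ /eqP->].
  have [s [[[_ regs] sI] ps]] := Iinf (p + 2)%N; exists s; split=> //.
    by apply: leq_trans ps; rewrite addn2.
  exact: leq_trans ps (leq_addl _ _).
have [y Py etay] := division_by_Omega (fun i => vec_op_sqr (w i))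
  (fun i j => vec_op_anticomm (w i) (w j)) (fun l q i => vec_op_degree (w i) l q)
  regs (fun a sa => proj1 (coefH a (sI a sa))) (fun a sa => proj2 (coefH a (sI a sa)))
  s_gt0 ps (fock_image_degree rhoE (ext_power_span he hE heta)) Wphi.
have [gamma sgamma gammay] := fock_image_surj rhoE hkp Py.
exists gamma; split; first by apply: ext_span_power sgamma.
(* [fock_image_inj] works within a single degree, so the product with [gamma] has to be placed in
   degree [p]. *)
have prod_span (u : seq 'I_k) q x : ext_span e iota q x ->
    ext_span e iota (size u + q) ((\prod_(i <- u) iota (omega i)) * x).
  move=> xq; elim: u => [|i u IHu]; first by rewrite big_nil mul1r.
  by rewrite big_cons -mulrA; apply: ext_span_mul.
apply/eqP; rewrite -subr_eq0; apply/eqP; apply: (fock_image_inj rhoE (q := p)).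
  apply: ext_spanD; first exact: ext_power_span heta.
  rewrite -scaleN1r; apply: ext_spanZ.
  have := prod_span (index_enum 'I_k) _ _ sgamma.
  by rewrite [X in size X]unlock -enumT size_enum_ord subnKC.
by rewrite fock_imageB fock_imageM rhoOm gammay etay subrr.
Qed.
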